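(* There exist a positive integer $n$ and a probability measure $\mu$ on $H_n=\{0,1\}^n$ such that $\mu$ has positive associations but $\mu$ is not UI.
   Context: $H_n=\{0,1\}^n$ is the $n$-dimensional discrete hypercube with the coordinatewise partial order. A subset of $H_n$ is closed upwards if together with each vector $v$ it contains every $w \in H_n$ with $w \ge v$ coordinatewise. A probability measure $\mu$ on $H_n$ has positive associations (PA) if $\mu(E_1\cap E_2)\ge\mu(E_1)\mu(E_2)$ for all closed-upwards subsets $E_1,E_2\subseteq H_n$. A probability measure $\mu$ on $H_n$ is called FUI (finitely many underlying independents) if there exist some $m$, independent (not necessarily identically distributed) Bernoulli ($\{0,1\}$-valued) random variables $Y_1,\dots,Y_m$, and coordinatewise non-decreasing functions $f_1,\dots,f_n:\{0,1\}^m\to\{0,1\}$ such that $\mu$ is the joint law of $(X_1,\dots,X_n)$, where $X_i=f_i(Y_1,\dots,Y_m)$. A probability measure on $H_n$ is called UI if it is a limit of a sequence of FUI measures on the same hypercube $H_n$ (i.e. pointwise convergence of the probabilities of each element of the finite set $H_n$). *)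

(* Defs.v *)
From HB Require Import structures.
From mathcomp Require Import all_boot all_order all_algebra.
From mathcomp Require Import all_classical all_reals all_analysis.

Set Implicit Arguments.
Unset Strict Implicit.
Unset Printing Implicit Defensive.

Import Order.TTheory GRing.Theory Num.Theory.
(* Equips [n.-tuple bool] with the coordinatewise order, where false < true. *)
Import Order.DefaultTupleProdOrder.

Local Open Scope classical_set_scope.
Local Open Scope ring_scope.

(* Tuples carry the product sigma-algebra; see [measurable_hypercube]. *)
Notation hypercube n := (n.-tuple bool).

Lemma le_hypercube n (v w : hypercube n) :
  (v <= w)%O = [forall i, tnth v i ==> tnth w i].
Proof.
rewrite leEtprod; apply: eq_forallb => i.
by case: (tnth v i) (tnth w i) => [] [].
Qed.

Lemma measurable_hypercube n (A : set (hypercube n)) : measurable A.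
Proof.
rewrite (_ : A = \bigcup_(v in A) [set v]); last first.
  by apply/seteqP; split => [v Av|v [w Aw /= ->]//]; exists v.
apply: fin_bigcup_measurable => [|v _]; first exact: finite_finset.
rewrite (_ : [set v] =
    \bigcap_(i in [set: 'I_n]) ((@tnth _ _)^~ i @^-1` [set tnth v i])).
  apply: fin_bigcap_measurable => // i _.
  by rewrite -[X in measurable X]setTI; exact: measurable_tnth.
apply/seteqP; split => [w /= -> //|w vw].
by apply: eq_from_tnth => i; exact: vw.
Qed.

Definition closed_upwards n (E : set (hypercube n)) : Prop :=
  forall v w, E v -> (v <= w)%O -> E w.

Definition positive_associations (R : realType) n
    (mu : probability (hypercube n) R) : Prop :=
  forall E1 E2 : set (hypercube n), closed_upwards E1 -> closed_upwards E2 ->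
    (mu E1 * mu E2 <= mu (E1 `&` E2))%E.

Definition mutually_independent (R : realType) d (T : measurableType d)
    (P : probability T R) d' (T' : measurableType d') m
    (Y : 'I_m -> {RV P >-> T'}) : Prop :=
  forall (J : {set 'I_m}) (B : 'I_m -> set T'),
    (forall j, measurable (B j)) ->
    P (\bigcap_(j in [set` J]) (Y j @^-1` B j)) =
    (\prod_(j in J) P (Y j @^-1` B j))%E.

Definition FUI (R : realType) n (mu : probability (hypercube n) R) : Prop :=
  exists (m : nat) (d : measure_display) (T : measurableType d)
         (P : probability T R) (Y : 'I_m -> {RV P >-> bool})
         (f : 'I_n -> hypercube m -> bool),
    [/\ mutually_independent Y,
        forall i, {homo f i : x y / (x <= y)%O} &
        forall A : set (hypercube n),
          mu A = pushforward P
            (fun w => [tuple f i [tuple Y j w | j < m] | i < n]) A].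

Definition UI (R : realType) n (mu : probability (hypercube n) R) : Prop :=
  exists nu : nat -> probability (hypercube n) R,
    (forall k, FUI (nu k)) /\
    forall v : hypercube n, nu k [set v] @[k --> \oo] --> mu [set v].

(* Main.v *)
(** Strong FKG inequality of Gladkov: let increasing events [A_i] of a product
    space have all pairwise intersections equal to [C], let [B] be the complement
    of their union, and put [t = P(C)], [b = P(B)], [u_i = P(A_i) - t].  Then
    [t b >= sum_(i<j) u_i u_j]; since [t + b + sum_i u_i = 1], this reads
    [(1 - t)^2 + (1 - b)^2 <= 1 + sum_i u_i^2].  In the second form it follows by
    induction on the number of coordinates.  Conditioning on one Bernoulli(p)
    coordinate, with [d] the increment between its two values, the defect of the
    mixture is the mixture of the defects plus
    [p (1 - p) (dt^2 + db^2 - sum_i du_i^2)], and this term is nonnegative since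
    [du_i = new_i - up_i] with [new_i, up_i >= 0], [sum_i up_i <= dt] and
    [sum_i new_i <= - db].

    The inequality is closed under limits.  Applied to the events "all coordinates
    but possibly the i-th are 1", it fails for the law on [{0,1}^3] giving mass
    1/6 to (1,1,1) and to each of its three lower neighbours, and 1/3 to (0,0,0);
    this law has positive associations. *)
Require Import Defs.
From HB Require Import structures.
From mathcomp Require Import all_boot all_order all_algebra.
From mathcomp Require Import all_classical all_reals all_analysis.
From mathcomp Require Import ring lra.

Set Implicit Arguments.
Unset Strict Implicit.
Unset Printing Implicit Defensive.

Import Order.TTheory GRing.Theory Num.Theory.
Import Order.DefaultTupleProdOrder numFieldNormedType.Exports.

Local Open Scope classical_set_scope.
Local Open Scope ring_scope.

(** * Finite expectations on the cube with product weights *)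

Section CubeMean.
Variable R : realFieldType.

Definition cube_mean m (w : 'I_m -> bool -> R) (g : hypercube m -> R) : R :=
  \sum_t (\prod_i w i (tnth t i)) * g t.

Lemma big_tuple_recl m (F : hypercube m.+1 -> R) :
  \sum_t F t = \sum_b \sum_(t : hypercube m) F [tuple of b :: t].
Proof.
rewrite pair_bigA /=.
rewrite (reindex (fun p : bool * hypercube m => [tuple of p.1 :: p.2])) //=.
exists (fun t => (thead t, [tuple of behead t])) => [[b t] _|t _] /=.
  by congr pair; apply: val_inj.
by rewrite -tuple_eta.
Qed.

(** Conditioning on the first coordinate; this drives the induction in [strong_FKG]. *)
Lemma cube_mean_recl m (w : 'I_m.+1 -> bool -> R) g :
  cube_mean w g = \sum_b w ord0 b *
    cube_mean (fun i => w (lift ord0 i)) (fun t => g [tuple of b :: t]).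
Proof.
rewrite /cube_mean big_tuple_recl; apply: eq_bigr => b _.
rewrite mulr_sumr; apply: eq_bigr => t _.
rewrite big_ord_recl tnth0 -!mulrA; congr (_ * (_ * _)).
by apply: eq_bigr => i _; rewrite tnthS.
Qed.

Lemma cube_meanB m (w : 'I_m -> bool -> R) g h :
  cube_mean w (fun t => g t - h t) = cube_mean w g - cube_mean w h.
Proof. by rewrite /cube_mean -sumrB; apply: eq_bigr => t _; rewrite mulrBr. Qed.

Lemma cube_mean_sum m (w : 'I_m -> bool -> R) (I : finType)
    (g : I -> hypercube m -> R) :
  cube_mean w (fun t => \sum_i g i t) = \sum_i cube_mean w (g i).
Proof. by rewrite exchange_big; apply: eq_bigr => t _; rewrite mulr_sumr. Qed.

Lemma ler_cube_mean m (w : 'I_m -> bool -> R) g h :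
  (forall i b, 0 <= w i b) -> (forall t, g t <= h t) ->
  cube_mean w g <= cube_mean w h.
Proof.
move=> w0 gh; apply: ler_sum => t _.
by apply: ler_wpM2l => //; apply: prodr_ge0.
Qed.

Lemma cube_mean_ge0 m (w : 'I_m -> bool -> R) g :
  (forall i b, 0 <= w i b) -> (forall t, 0 <= g t) -> 0 <= cube_mean w g.
Proof.
by move=> w0 g0; apply: sumr_ge0 => t _; apply: mulr_ge0 => //; apply: prodr_ge0.
Qed.

End CubeMean.

(** * The strong FKG inequality for monotone maps into a fan *)

Section Fan.
Variables (R : realFieldType) (I : finType).

(* [None] is the bottom, [Some None] the top, and the [Some (Some i)] form an
   antichain in between. *)
Definition fan_le (a b : option (option I)) :=
  [|| a == b, a == None | b == Some None].

Definition fan_law m (w : 'I_m -> bool -> R)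
    (f : hypercube m -> option (option I)) c : R :=
  cube_mean w (fun t => (f t == c)%:R).

Lemma sum_sqr_le (a : I -> R) :
  (forall i, 0 <= a i) -> \sum_i a i ^+ 2 <= (\sum_i a i) ^+ 2.
Proof.
move=> a0; rewrite expr2 mulr_suml; apply: ler_sum => i _.
rewrite expr2 ler_wpM2l // (bigD1 i) //= lerDl.
by apply: sumr_ge0.
Qed.

(** Distinct middle colours are incomparable, so a middle colour [i] is gained only from the bottom
    ([new i]) and lost only to the top ([up i]). *)
Lemma fan_increment m (w : 'I_m -> bool -> R)
    (f0 f1 : hypercube m -> option (option I)) :
    (forall i b, 0 <= w i b) -> (forall t, fan_le (f0 t) (f1 t)) ->
  \sum_i (fan_law w f1 (Some (Some i)) - fan_law w f0 (Some (Some i))) ^+ 2 <=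
    (fan_law w f1 (Some None) - fan_law w f0 (Some None)) ^+ 2 +
    (fan_law w f1 None - fan_law w f0 None) ^+ 2.
Proof.
move=> w0 f01; set pr := fan_law w.
pose up i := cube_mean w
  (fun t => ((f0 t == Some (Some i)) && (f1 t == Some None))%:R).
pose new i := cube_mean w
  (fun t => ((f0 t == None) && (f1 t == Some (Some i)))%:R).
have up0 i : 0 <= up i by apply: cube_mean_ge0 => // t; apply: ler0n.
have new0 i : 0 <= new i by apply: cube_mean_ge0 => // t; apply: ler0n.
have dE i : pr f1 (Some (Some i)) - pr f0 (Some (Some i)) = new i - up i.
  rewrite /pr /fan_law /new /up -!cube_meanB; apply: eq_bigr => t _; congr (_ * _).
  move: (f01 t); rewrite /fan_le.
  case: (f0 t) (f1 t) => [[j|]|] [[k|]|] //=;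
    rewrite ?andbT ?andbF ?subrr ?subr0 ?sub0r//.
  by rewrite !orbF => /eqP ->; rewrite subrr.
(* Only an inequality: a direct jump from bottom to top is counted by no [up i], and likewise by no
   [new i] below. *)
have sum_up : \sum_i up i <= pr f1 (Some None) - pr f0 (Some None).
  rewrite /up /pr /fan_law -cube_mean_sum -cube_meanB; apply: ler_cube_mean => // t.
  move: (f01 t); rewrite /fan_le.
  case: (f0 t) (f1 t) => [[j|]|] [[k|]|] //= _;
    try by rewrite ?subrr ?subr0 big1 // => i _; rewrite andbF.
  rewrite subr0 (bigD1 j) //= big1 ?eqxx ?addr0 // => i /negPf ij.
  by rewrite !(inj_eq Some_inj) eq_sym ij.
have sum_new : \sum_i new i <= pr f0 None - pr f1 None.
  rewrite /new /pr /fan_law -cube_mean_sum -cube_meanB; apply: ler_cube_mean => // t.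
  move: (f01 t); rewrite /fan_le.
  case: (f0 t) (f1 t) => [[j|]|] [[k|]|] //= _;
    try by rewrite ?subrr ?subr0 big1.
  rewrite subr0 (bigD1 k) //= big1 ?eqxx ?addr0 // => i /negPf ij.
  by rewrite !(inj_eq Some_inj) eq_sym ij.
(* Dropping the cross term [- 2 * up i * new i] separates the two sums, each then bounded by the
   square of a total. *)
apply: (@le_trans _ _ (\sum_i (up i ^+ 2 + new i ^+ 2))).
  by apply: ler_sum => i _; rewrite dE; have := mulr_ge0 (up0 i) (new0 i); nra.
rewrite big_split /= lerD //.
  apply: le_trans (sum_sqr_le up0) _.
  by rewrite lerXn2r ?nnegrE ?sumr_ge0 // (le_trans _ sum_up) ?sumr_ge0.
apply: le_trans (sum_sqr_le new0) _; rewrite -(sqrrN (pr f1 None - _)) opprB.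
by rewrite lerXn2r ?nnegrE ?sumr_ge0 // (le_trans _ sum_new) ?sumr_ge0.
Qed.

(** Here [Some None] stands for [C], [None] for [B], and [Some (Some i)] for the part of [A_i]
    outside [C]. *)
Lemma strong_FKG m (w : 'I_m -> bool -> R)
    (f : hypercube m -> option (option I)) :
    (forall i b, 0 <= w i b) -> (forall i, w i true + w i false = 1) ->
    (forall s t : hypercube m, (s <= t)%O -> fan_le (f s) (f t)) ->
  (1 - fan_law w f (Some None)) ^+ 2 + (1 - fan_law w f None) ^+ 2
    <= 1 + \sum_i fan_law w f (Some (Some i)) ^+ 2.
Proof.
elim: m w f => [|m IH] w f w0 w1 fmono; set pr := fan_law w f.
  (* The cube of dimension 0 is a single point, so the law is a point mass and equality holds for
     each colour. *)
  have prE c : pr c = (f [tuple] == c)%:R.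
    rewrite /pr /fan_law /cube_mean (bigD1 [tuple]) //= big_ord0 mul1r.
    by rewrite [X in _ + X]big1 ?addr0 // => t; rewrite (tuple0 t).
  move: (f [tuple]) prE => [[j|]|] prE; rewrite !prE /=.
  - rewrite (bigD1 j) //= prE eqxx subr0 expr1n lerD2l lerDl.
    by apply: sumr_ge0 => i _; apply: sqr_ge0.
  - rewrite subrr subr0 expr0n add0r expr1n lerDl.
    by apply: sumr_ge0 => i _; apply: sqr_ge0.
  - rewrite subrr subr0 expr0n addr0 expr1n lerDl.
    by apply: sumr_ge0 => i _; apply: sqr_ge0.
pose w' (i : 'I_m) := w (lift ord0 i).
pose f' b (t : hypercube m) := f [tuple of b :: t].
pose pr' b := fan_law w' (f' b).
have prE c : pr c = w ord0 true * pr' true c + w ord0 false * pr' false c.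
  by rewrite /pr /fan_law cube_mean_recl big_bool.
(* Used with [b = b'] for monotonicity of each slice, and with [false <= true] to compare the two
   slices. *)
have le_cons b b' (s t : hypercube m) : (b <= b')%O -> (s <= t)%O ->
    ([tuple of b :: s] <= [tuple of b' :: t])%O.
  rewrite !le_hypercube => bb' /forallP st; apply/forallP => i.
  case: (unliftP ord0 i) => [j ->|->]; rewrite ?tnthS ?tnth0 //.
  by case: b b' bb' => [] [].
have IHb b : (1 - pr' b (Some None)) ^+ 2 + (1 - pr' b None) ^+ 2
    <= 1 + \sum_i pr' b (Some (Some i)) ^+ 2.
  by apply: IH => [i b'|i|s t st]; [exact: w0|exact: w1|exact/fmono/le_cons].
have inc := @fan_increment m w' (f' false) (f' true) (fun i => w0 _)
  (fun t => fmono _ _ (le_cons false true t t isT (lexx t))).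
rewrite -!/(pr' _) in inc.
move: (IHb true) (IHb false) (w0 ord0 true) (w0 ord0 false) (w1 ord0).
set p := w ord0 true; set q := w ord0 false => IH1 IH0 p0 q0 pq1.
have qE : q = 1 - p by rewrite -pq1 addrC addKr.
rewrite !prE -/p -/q.
(* Variance identity: [(p x + q y)^2 = p x^2 + q y^2 - p q (x - y)^2] when [p + q = 1]. It is
   applied again to the left-hand side below. *)
have -> : \sum_i pr (Some (Some i)) ^+ 2 =
    p * \sum_i pr' true (Some (Some i)) ^+ 2
    + q * \sum_i pr' false (Some (Some i)) ^+ 2
    - p * q * \sum_i (pr' true (Some (Some i)) - pr' false (Some (Some i))) ^+ 2.
  rewrite !mulr_sumr -big_split -sumrB; apply: eq_bigr => i _.
  by rewrite prE -/p -/q qE /=; ring.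
have := mulr_ge0 p0 q0.
move: inc IH1 IH0.
set S := \sum_i _; set S1 := \sum_i _; set S0 := \sum_i _.
set t1 := pr' true (Some None); set t0 := pr' false (Some None).
set b1 := pr' true None; set b0 := pr' false None => inc IH1 IH0 pq.
have h1 := ler_wpM2l p0 IH1; have h0 := ler_wpM2l q0 IH0.
have h := ler_wpM2l pq inc.
have -> : (1 - (p * t1 + q * t0)) ^+ 2 + (1 - (p * b1 + q * b0)) ^+ 2 =
   p * ((1 - t1) ^+ 2 + (1 - b1) ^+ 2) + q * ((1 - t0) ^+ 2 + (1 - b0) ^+ 2)
   - p * q * ((t1 - t0) ^+ 2 + (b1 - b0) ^+ 2).
  by rewrite qE; ring.
move: h h1 h0; rewrite qE; lra.
Qed.

End Fan.

(** * From FUI measures to a closed inequality between point masses *)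

Section FUILaw.
Variable R : realType.

Lemma independent_law d (T : measurableType d) (P : probability T R) m
    (Y : 'I_m -> {RV P >-> bool}) (A : set (hypercube m)) :
    mutually_independent Y ->
  P ((fun x => [tuple Y j x | j < m]) @^-1` A) =
    (cube_mean (fun j b => fine (P (Y j @^-1` [set b])))
      (fun t => (t \in A)%:R))%:E.
Proof.
move=> indY; set Yt := fun x => _.
have mY j b : measurable (Y j @^-1` [set b]) by exact: measurable_funPTI.
have YtE t : Yt @^-1` [set t] =
    \bigcap_(j in [set` [set: 'I_m]%SET]) (Y j @^-1` [set tnth t j]).
  apply/seteqP; split => x /= => [<- j _ /=|Yx]; first by rewrite tnth_mktuple.
  by apply: eq_from_tnth => j; rewrite tnth_mktuple; apply: Yx; rewrite /= inE.
have mYt t : measurable (Yt @^-1` [set t]).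
  rewrite YtE; apply: fin_bigcap_measurable => [|j _]; last exact: mY.
  exact: finite_finset.
have PYt t : P (Yt @^-1` [set t]) =
    (\prod_j fine (P (Y j @^-1` [set tnth t j])))%:E.
  rewrite YtE indY // -prodEFin.
  by apply: eq_big => [j|j _]; rewrite ?finset.in_setT // fineK ?fin_num_measure.
(* Points outside [A] contribute [set0], so the union runs over the whole cube, as the sum in
   [cube_mean] does. *)
have -> : Yt @^-1` A =
    \bigcup_(t in [set` index_enum (hypercube m)])
      (if t \in A then Yt @^-1` [set t] else set0).
  apply/seteqP; split => x /= => [Ax|[t _]].
    by exists (Yt x); rewrite /= ?mem_index_enum // mem_set.
  by case: ifPn => // /[swap] /= <- /set_mem.
rewrite measure_fin_bigcup; last first.
- by move=> t _; case: ifP.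
- move=> s t _ _ [x []]; case: ifP => // _ /= <-.
  by case: ifP.
- exact: finite_finset.
rewrite -fsbig_seq ?index_enum_uniq // /cube_mean -sumEFin.
apply: eq_bigr => t _; case: ifP => _; last by rewrite measure0 mulr0.
by rewrite mulr1; exact: PYt.
Qed.

(** Replaces the abstract probability space by a finite weighted cube, to which [strong_FKG]
    applies. *)
Lemma FUI_cube_mean n (nu : probability (hypercube n) R) : FUI nu ->
  exists (m : nat) (w : 'I_m -> bool -> R) (F : hypercube m -> hypercube n),
    [/\ forall i b, 0 <= w i b, forall i, w i true + w i false = 1,
        forall s t, (s <= t)%O -> (F s <= F t)%O &
        forall A, nu A = (cube_mean w (fun t => (F t \in A)%:R))%:E].
Proof.
move=> [m [d [T [P [Y [f [indY fmono nuE]]]]]]].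
exists m, (fun j b => fine (P (Y j @^-1` [set b]))),
  (fun t => [tuple f i t | i < n]).
have mY j b : measurable (Y j @^-1` [set b]) by exact: measurable_funPTI.
split => [i b|i|s t st|A].
- by rewrite fine_ge0.
- apply: EFin_inj; rewrite EFinD !fineK ?fin_num_measure //.
  rewrite -measureU //.
    by rewrite -preimage_setU -setT_bool preimage_setT; exact: probability_setT.
  rewrite -preimage_setI [X in _ @^-1` X](_ : _ = set0) ?preimage_set0 //.
  by apply/seteqP; split => // b [-> ].
- rewrite le_hypercube; apply/forallP => i; rewrite !tnth_mktuple.
  by have := fmono i _ _ st; case: (f i s) (f i t) => [] [].
- by rewrite nuE /pushforward -(independent_law _ indY).
Qed.

Definition all_ones n : hypercube n := [tuple true | _ < n].

Definition all_but n (i : 'I_n) : hypercube n := [tuple j != i | j < n].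

Lemma all_ones_neq_all_but n (i : 'I_n) : (all_ones n == all_but i) = false.
Proof.
by apply/eqP => /(congr1 (fun t => tnth t i)); rewrite !tnth_mktuple eqxx.
Qed.

Lemma all_but_inj n : injective (@all_but n).
Proof.
move=> i j /(congr1 (fun t => tnth t i)).
by rewrite !tnth_mktuple eqxx => /esym/negbFE/eqP.
Qed.

(** Encodes the increasing events [{all_ones n, all_but i}], whose pairwise intersections are
    [{all_ones n}]. Every point below the two top layers is sent to [None]. *)
Definition fan_color n (x : hypercube n) : option (option 'I_n) :=
  if x == all_ones n then Some None else omap Some [pick i | x == all_but i].

Lemma fan_color_top n (x : hypercube n) :
  (fan_color x == Some None) = (x == all_ones n).
Proof. by rewrite /fan_color; case: (x == _) => //; case: pickP. Qed.

Lemma fan_color_mid n (x : hypercube n) i :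
  (fan_color x == Some (Some i)) = (x == all_but i).
Proof.
rewrite /fan_color; have [->|_] := eqVneq x (all_ones n).
  by rewrite all_ones_neq_all_but.
case: pickP => [j /eqP ->|/(_ i) ->] //=.
by rewrite !(inj_eq Some_inj) (inj_eq (@all_but_inj n)).
Qed.

(** Each [all_but i] is a coatom: only itself and [all_ones n] lie above it. *)
Lemma fan_color_le n (x y : hypercube n) :
  (x <= y)%O -> fan_le (fan_color x) (fan_color y).
Proof.
rewrite le_hypercube => /forallP xy; rewrite /fan_le.
case xE: (fan_color x) => [[i|]|]; last by rewrite orbT.
- move/eqP: xE; rewrite fan_color_mid => /eqP xE.
  have yj j : j != i -> tnth y j.
    by move=> ji; have := xy j; rewrite xE tnth_mktuple ji.
  case yi: (tnth y i).
    suff -> : fan_color y = Some None by rewrite !orbT.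
    apply/eqP; rewrite fan_color_top; apply/eqP/eq_from_tnth => j.
    by rewrite tnth_mktuple; have [->|/yj] := eqVneq j i.
  suff -> : fan_color y = Some (Some i) by rewrite eqxx.
  apply/eqP; rewrite fan_color_mid; apply/eqP/eq_from_tnth => j.
  by rewrite tnth_mktuple; have [->|/yj] := eqVneq j i.
- move/eqP: xE; rewrite fan_color_top => /eqP xE.
  suff -> : fan_color y = Some None by rewrite eqxx.
  apply/eqP; rewrite fan_color_top; apply/eqP/eq_from_tnth => j.
  by have := xy j; rewrite xE !tnth_mktuple.
Qed.

(** Eliminates the bottom colour, so that the inequality involves only the masses of points in the
    two top layers. *)
Lemma fan_color_bot n (x : hypercube n) :
  (fan_color x == None)%:R =
    1 - (x == all_ones n)%:R - \sum_i (x == all_but i)%:R :> R.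
Proof.
rewrite -fan_color_top; under eq_bigr do rewrite -fan_color_mid.
case: (fan_color x) => [[i|]|] /=.
- rewrite (bigD1 i) //= eqxx big1 ?addr0 ?subr0 ?subrr // => j /negPf ji.
  by rewrite !(inj_eq Some_inj) eq_sym ji.
- by rewrite big1 ?subr0 ?subrr.
- by rewrite big1 ?subr0.
Qed.

Definition mass n (nu : probability (hypercube n) R) v : R := fine (nu [set v]).

Lemma FUI_ineq n (nu : probability (hypercube n) R)  : FUI nu ->
  (1 - mass nu (all_ones n)) ^+ 2
      + (mass nu (all_ones n) + \sum_i mass nu (all_but i)) ^+ 2
    <= 1 + \sum_i mass nu (all_but i) ^+ 2.
Proof.
move=> /FUI_cube_mean [m [w [F [w0 w1 Fmono nuE]]]]; set pr := mass nu.
have prE v : pr v = cube_mean w (fun t => (F t == v)%:R).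
  by rewrite /pr /mass nuE /=; apply: eq_bigr => t _; rewrite in_set1.
(* The total weight is read off from [nu] having total mass 1. *)
have mean1 : cube_mean w (fun=> 1) = 1.
  apply: EFin_inj; rewrite -(@probability_setT _ _ _ nu) nuE; congr EFin.
  by apply: eq_bigr => t _; rewrite in_setT.
have := strong_FKG w0 w1 (fun s t st => fan_color_le (Fmono s t st)).
have topE : fan_law w (fun t => fan_color (F t)) (Some None) = pr (all_ones n).
  by rewrite prE; apply: eq_bigr => t _; rewrite fan_color_top.
have midE i :
    fan_law w (fun t => fan_color (F t)) (Some (Some i)) = pr (all_but i).
  by rewrite prE; apply: eq_bigr => t _; rewrite fan_color_mid.
have -> : fan_law w (fun t => fan_color (F t)) None =
    1 - pr (all_ones n) - \sum_i pr (all_but i).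
  rewrite prE (eq_bigr _ (fun i _ => prE (all_but i))) -cube_mean_sum -{1}mean1.
  by rewrite -!cube_meanB; apply: eq_bigr => t _; rewrite fan_color_bot.
rewrite topE; under [X in _ <= _ + X -> _]eq_bigr do rewrite midE.
set S := \sum_i pr _.
by rewrite (_ : 1 - (1 - _ - S) = pr (all_ones n) + S) //; ring.
Qed.

(** Both sides are polynomials in finitely many point masses, hence continuous under pointwise
    convergence. *)
Lemma UI_ineq n (mu : probability (hypercube n) R)  : UI mu ->
  (1 - mass mu (all_ones n)) ^+ 2
      + (mass mu (all_ones n) + \sum_i mass mu (all_but i)) ^+ 2
    <= 1 + \sum_i mass mu (all_but i) ^+ 2.
Proof.
move=> [nu [nuFUI nu_mu]].
have cvg_mass v : mass (nu k) v @[k --> \oo] --> mass mu v.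
  apply: fine_cvg; rewrite /mass fineK; first exact: nu_mu.
  by apply: fin_num_measure; exact: measurable_hypercube.
pose lhs (a : hypercube n -> R) :=
  (1 - a (all_ones n)) ^+ 2 + (a (all_ones n) + \sum_i a (all_but i)) ^+ 2.
pose rhs (a : hypercube n -> R) := 1 + \sum_i a (all_but i) ^+ 2.
have cvg_lhs : lhs (mass (nu k)) @[k --> \oo] --> lhs (mass mu).
  have cvg_sum : \sum_i mass (nu k) (all_but i) @[k --> \oo] -->
      (\sum_i mass mu (all_but i) : R).
    by apply: cvg_big => [|i _]; [exact: add_continuous|exact: cvg_mass].
  apply: cvgD; rewrite expr2; under eq_fun do rewrite expr2.
    by apply: cvgM; (apply: cvgB; [exact: cvg_cst|exact: cvg_mass]).
  by apply: cvgM; apply: cvgD.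
have cvg_rhs : rhs (mass (nu k)) @[k --> \oo] --> rhs (mass mu).
  apply: cvgD; first exact: cvg_cst.
  apply: cvg_big => [|i _]; first exact: add_continuous.
  rewrite expr2; under eq_fun do rewrite expr2.
  by apply: cvgM; exact: cvg_mass.
by apply: (ler_cvg_to cvg_lhs cvg_rhs); near=> k; exact: FUI_ineq.
Unshelve. all: by end_near. Qed.

End FUILaw.

(** * The counterexample in dimension 3 *)

Section Triangle.
Variable R : realType.

Definition zeros n : hypercube n := [tuple false | _ < n].

(** Six Dirac masses of weight 1/6, two of them at [zeros 3]. [inord] appears because [msum] is
    indexed by natural numbers. *)
Definition triangle_law : set (hypercube 3) -> \bar R :=
  mscale (6^-1)%:nng
    (measure_add (measure_add \d_(all_ones 3)
                              (msum (fun k => \d_(all_but (inord k : 'I_3))) 3))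
                 (msum (fun=> \d_(zeros 3)) 2)).

HB.instance Definition _ := Measure.on triangle_law.

Lemma triangle_lawE A : triangle_law A =
  (6^-1 * ((all_ones 3 \in A)%:R + \sum_i (all_but i \in A)%:R
           + 2 * (zeros 3 \in A)%:R))%:E.
Proof.
rewrite /triangle_law /mscale /= /msum 2!big_ord_recl big_ord0 adde0 /=.
rewrite {1}/msum 2!big_ord_recl big_ord0 adde0 /=.
rewrite EFinM !EFinD -sumEFin.
congr (_ * (_ + _ + _))%E.
  by apply: eq_bigr => i _; rewrite -[in RHS](inord_val i); exact: diracE.
by rewrite /msum !big_ord_recr big_ord0 /= add0e /dirac -EFinD -mulr2n mulr_natl indicE.
Qed.

Lemma triangle_law_setT : triangle_law setT = 1%E.
Proof.
rewrite triangle_lawE; under eq_bigr do rewrite in_setT.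
rewrite !in_setT sumr_const card_ord; congr EFin => /=; lra.
Qed.

HB.instance Definition _ :=
  Measure_isProbability.Build _ _ _ triangle_law triangle_law_setT.

Lemma zeros_le n (x : hypercube n) : (zeros n <= x)%O.
Proof. by rewrite le_hypercube; apply/forallP => i; rewrite tnth_mktuple. Qed.

Lemma le_all_ones n (x : hypercube n) : (x <= all_ones n)%O.
Proof.
by rewrite le_hypercube; apply/forallP => i; rewrite tnth_mktuple implybT.
Qed.

(** Only membership of the five support points matters, which leaves finitely many cases. One is
    tight: if [E] holds one middle point and [F] the other two, neither containing [zeros 3], then
    [(2/6) (3/6) = 1/6]. *)
Lemma triangle_law_PA : positive_associations triangle_law.
Proof.
move=> E F upE upF.
have up (G : set (hypercube 3)) v w : closed_upwards G -> (v <= w)%O ->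
    (v \in G) ==> (w \in G).
  by move=> upG vw; apply/implyP => /set_mem Gv; apply/mem_set/(upG v).
rewrite /= !triangle_lawE -EFinM lee_fin !in_setI.
rewrite !big_ord_recr !big_ord0 /= !in_setI.
set i0 := widen_ord _ _; set i1 := widen_ord _ _; set i2 := ord_max.
have zero_up G (i : 'I_3) (upG : closed_upwards G) :=
  up G _ _ upG (zeros_le (all_but i)).
have one_up G (i : 'I_3) (upG : closed_upwards G) :=
  up G _ _ upG (le_all_ones (all_but i)).
move: (zero_up E i0 upE) (zero_up E i1 upE) (zero_up E i2 upE).
move: (one_up E i0 upE) (one_up E i1 upE) (one_up E i2 upE).
move: (zero_up F i0 upF) (zero_up F i1 upF) (zero_up F i2 upF).
move: (one_up F i0 upF) (one_up F i1 upF) (one_up F i2 upF).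
(* The six implications discard the membership patterns that are not upward closed. *)
do 5![case: (_ \in F)] => //= _ _ _ _ _ _.
all: by do 5![case: (_ \in E)] => //= *; lra.
Qed.

Lemma triangle_law_not_UI : ~ UI triangle_law.
Proof.
have ones_but i : (all_but i == all_ones 3) = false.
  by rewrite eq_sym all_ones_neq_all_but.
have zeros_ones : (zeros 3 == all_ones 3) = false.
  by apply/eqP => /(congr1 (fun t => tnth t ord0)); rewrite !tnth_mktuple.
have zeros_but (i : 'I_3) : (zeros 3 == all_but i) = false.
  (* Two coordinates are compared because [all_but i] has a single zero: the last one forces
     [i = ord_max], and the first then gives a contradiction. *)
  apply/eqP => E; have := congr1 (fun t => tnth t ord0) E.
  have := congr1 (fun t => tnth t ord_max) E; rewrite !tnth_mktuple.
  by move=> /esym/negbFE/eqP <-.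
have ones_mass : mass triangle_law (all_ones 3) = 6^-1.
  rewrite /mass /= triangle_lawE /= !in_set1 eqxx zeros_ones.
  rewrite big1 => [|i _]; first by rewrite /=; lra.
  by rewrite in_set1 ones_but.
have but_mass i : mass triangle_law (all_but i) = 6^-1.
  rewrite /mass /= triangle_lawE /= !in_set1 all_ones_neq_all_but zeros_but.
  rewrite (bigD1 i) //= in_set1 eqxx big1 => [|j /negPf ji].
    by rewrite /=; lra.
  by rewrite in_set1 (inj_eq (@all_but_inj _)) ji.
(* The inequality would read [(5/6)^2 + (4/6)^2 <= 1 + 3/36], that is [41/36 <= 39/36]. *)
move=> /UI_ineq; rewrite ones_mass.
under eq_bigr do rewrite but_mass.
under [X in _ <= 1 + X]eq_bigr do rewrite but_mass.
rewrite !sumr_const card_ord; lra.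
Qed.

End Triangle.

Theorem theorem3p5 (R : realType) :
  exists (n : nat) (mu : probability (hypercube n) R),
    [/\ (0 < n)%N, positive_associations mu & ~ UI mu].
Proof.
exists 3%N, (triangle_law R).
by split; [|exact: triangle_law_PA|exact: triangle_law_not_UI].
Qed.
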